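(* Let $A_t\in\mathbb{R}_{\geq 0}^{M\times N}$ for $t=1,\dots,T$ and $Y\in\mathbb{R}_{\geq 0}^{M\times T}$, and let $\alpha,\lambda_B,\mu_B,\lambda_C,\mu_C,\lambda_X,\mu_X,\tau\geq 0$. For $B\in\mathbb{R}_{\geq 0}^{N\times K}$, $C\in\mathbb{R}_{\geq 0}^{K\times T}$, $X\in\mathbb{R}_{\geq 0}^{N\times T}$ define the cost function $$\mathcal{F}(B,C,X)=\sum_{t=1}^{T}\frac12\Vert A_tX_{\bullet,t}-Y_{\bullet,t}\Vert_2^2+\frac{\alpha}{2}\Vert BC-X\Vert_F^2+\lambda_B\Vert B\Vert_1+\frac{\mu_B}{2}\Vert B\Vert_F^2+\lambda_C\Vert C\Vert_1+\frac{\mu_C}{2}\Vert C\Vert_F^2+\lambda_X\Vert X\Vert_1+\frac{\mu_X}{2}\Vert X\Vert_F^2+\frac{\tau}{2}\operatorname{TV}(B).$$ Then, for any initialisations $X^{[0]}\in\mathbb{R}_{>0}^{N\times T}$, $B^{[0]}\in\mathbb{R}_{>0}^{N\times K}$, $C^{[0]}\in\mathbb{R}_{>0}^{K\times T}$, the alternating update rules (for $d=0,1,2,\dots$) $$X_{\bullet,t}^{[d+1]}=X_{\bullet,t}^{[d]}\circ\frac{A_t^\intercal Y_{\bullet,t}+\alpha B^{[d]}C_{\bullet,t}^{[d]}}{A_t^\intercal A_tX_{\bullet,t}^{[d]}+(\mu_X+\alpha)X_{\bullet,t}^{[d]}+\lambda_X\mathbf{1}_{N\times 1}}\qquad (t=1,\dots,T),$$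 $$B^{[d+1]}=B^{[d]}\circ\frac{\alpha X^{[d+1]}{C^{[d]}}^\intercal+\tau P(B^{[d]})\circ Z(B^{[d]})}{\alpha B^{[d]}C^{[d]}{C^{[d]}}^\intercal+\mu_BB^{[d]}+\lambda_B\mathbf{1}_{N\times K}+\tau B^{[d]}\circ P(B^{[d]})},$$ $$C^{[d+1]}=C^{[d]}\circ\frac{\alpha {B^{[d+1]}}^\intercal X^{[d+1]}}{\alpha {B^{[d+1]}}^\intercal B^{[d+1]}C^{[d]}+\mu_CC^{[d]}+\lambda_C\mathbf{1}_{K\times T}}$$ lead to a monotonic decrease of the cost function, i.e. $\mathcal{F}(B^{[d+1]},C^{[d+1]},X^{[d+1]})\leq\mathcal{F}(B^{[d]},C^{[d]},X^{[d]})$ for all $d\geq 0$.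
   Context: $M,N,T,K$ are positive integers. For a matrix $M$, $M_{\bullet,t}$ denotes its $t$-th column and $M_{n,\bullet}$ its $n$-th row. $\Vert\cdot\Vert_F$ is the Frobenius norm, $\Vert M\Vert_1=\sum_{ij}|M_{ij}|$. The symbol $\circ$ denotes the entrywise (Hadamard) product and the fractions of matrices/vectors are entrywise quotients; $\mathbf{1}_{M\times N}$ is the $M\times N$ matrix with all entries $1$. The strictly positive initialisation is imposed so that the divisions in the update rules are well defined. Smoothed isotropic total variation: the row indices $n\in\{1,\dots,N\}$ of $B$ represent pixels. For every $n$ a set $\mathcal{N}_n\subset\{1,\dots,N\}$ of indices of spatially neighbouring pixels is fixed (for instance, in two dimensions the neighbours $(1,0)$ and $(0,1)$ for the pixel $(0,0)$), and $\varepsilon_{\mathrm{TV}}>0$ is a fixed constant. For $B\in\mathbb{R}^{N\times K}$, $$\operatorname{TV}(B)=\sum_{k=1}^K\sum_{n=1}^N|\nabla_{nk}B|,\qquad |\nabla_{nk}B|=\sqrt{\varepsilon_{\mathrm{TV}}^2+\sum_{\ell\in\mathcal{N}_n}(B_{nk}-B_{\ell k})^2}.$$ The adjoint neighbourhood $\bar{\mathcal{N}}_n$ is defined by $\ell\in\bar{\mathcal{N}}_n\Leftrightarrow n\in\mathcal{N}_\ell$. The matrices $P(B),Z(B)\in\mathbb{R}_{\geq0}^{N\times K}$ are $$P(B)_{nk}=\frac{1}{|\nabla_{nk}B|}\sum_{\ell\in\mathcal{N}_n}1+\sum_{\ell\in\bar{\mathcal{N}}_n}\frac{1}{|\nabla_{\ell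 k}B|},$$ $$Z(B)_{nk}=\frac{1}{P(B)_{nk}}\left(\frac{1}{|\nabla_{nk}B|}\sum_{\ell\in\mathcal{N}_n}\frac{B_{nk}+B_{\ell k}}{2}+\sum_{\ell\in\bar{\mathcal{N}}_n}\frac{B_{nk}+B_{\ell k}}{2|\nabla_{\ell k}B|}\right).$$ *)

(* Defs.v *)
From mathcomp Require Import all_boot all_order all_algebra.
From mathcomp Require Import reals.

Set Implicit Arguments.
Unset Strict Implicit.
Unset Printing Implicit Defensive.

Import Order.TTheory GRing.Theory Num.Theory.
Local Open Scope ring_scope.

Declare Scope entrywise_scope.
Delimit Scope entrywise_scope with EW.
Open Scope entrywise_scope.

Definition hadamard (R : realType) (m n : nat) (A B : 'M[R]_(m, n)) :
  'M[R]_(m, n) := map2_mx (fun x y => x * y) A B.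

(* Division in a field is total, with x / 0 = 0; an entry of the quotient with
   a zero denominator is therefore 0. *)
Definition hquot (R : realType) (m n : nat) (A B : 'M[R]_(m, n)) :
  'M[R]_(m, n) := map2_mx (fun x y => x / y) A B.

Notation "A ⊙ B" := (hadamard A B)
  (at level 40, left associativity) : entrywise_scope.
Notation "A ⊘ B" := (hquot A B)
  (at level 40, left associativity) : entrywise_scope.

Definition mx_nonneg (R : realType) (m n : nat) (A : 'M[R]_(m, n)) : Prop :=
  forall i j, 0 <= A i j.

Definition mx_pos (R : realType) (m n : nat) (A : 'M[R]_(m, n)) : Prop :=
  forall i j, 0 < A i j.

Definition norm2 (R : realType) (m : nat) (v : 'cV[R]_m) : R :=
  Num.sqrt (\sum_i v i 0 ^+ 2).

Definition normF (R : realType) (m n : nat) (A : 'M[R]_(m, n)) : R :=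
  Num.sqrt (\sum_i \sum_j A i j ^+ 2).

(* Entrywise 1-norm, not the induced operator norm. *)
Definition norm1 (R : realType) (m n : nat) (A : 'M[R]_(m, n)) : R :=
  \sum_i \sum_j `|A i j|.

Definition adj_nbr (N : nat) (nbr : 'I_N -> {set 'I_N}) (n : 'I_N) :
  {set 'I_N} := [set l | n \in nbr l].

Definition grad_abs (R : realType) (N K : nat) (eps : R)
  (nbr : 'I_N -> {set 'I_N}) (B : 'M[R]_(N, K)) (n : 'I_N) (k : 'I_K) : R :=
  Num.sqrt (eps ^+ 2 + \sum_(l in nbr n) (B n k - B l k) ^+ 2).

Definition TV (R : realType) (N K : nat) (eps : R)
  (nbr : 'I_N -> {set 'I_N}) (B : 'M[R]_(N, K)) : R :=
  \sum_(k < K) \sum_(n < N) grad_abs eps nbr B n k.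

Definition TV_P (R : realType) (N K : nat) (eps : R)
  (nbr : 'I_N -> {set 'I_N}) (B : 'M[R]_(N, K)) : 'M[R]_(N, K) :=
  \matrix_(n < N, k < K)
    ((grad_abs eps nbr B n k)^-1 * (\sum_(l in nbr n) 1)
     + \sum_(l in adj_nbr nbr n) (grad_abs eps nbr B l k)^-1).

(* If pixel n has no neighbour and is no pixel's neighbour, P(B)_nk is 0 and
   hence Z(B)_nk is 0. *)
Definition TV_Z (R : realType) (N K : nat) (eps : R)
  (nbr : 'I_N -> {set 'I_N}) (B : 'M[R]_(N, K)) : 'M[R]_(N, K) :=
  \matrix_(n < N, k < K)
    ((TV_P eps nbr B n k)^-1 *
     ((grad_abs eps nbr B n k)^-1 * (\sum_(l in nbr n) (B n k + B l k) / 2)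
      + \sum_(l in adj_nbr nbr n)
          (B n k + B l k) / (2 * grad_abs eps nbr B l k))).

Definition cost (R : realType) (M N T K : nat)
  (A : 'I_T -> 'M[R]_(M, N)) (Y : 'M[R]_(M, T))
  (alpha lambdaB muB lambdaC muC lambdaX muX tau eps : R)
  (nbr : 'I_N -> {set 'I_N})
  (B : 'M[R]_(N, K)) (C : 'M[R]_(K, T)) (X : 'M[R]_(N, T)) : R :=
  \sum_(t < T) (2^-1 * norm2 (A t *m col t X - col t Y) ^+ 2)
  + alpha / 2 * normF (B *m C - X) ^+ 2
  + lambdaB * norm1 B + muB / 2 * normF B ^+ 2
  + lambdaC * norm1 C + muC / 2 * normF C ^+ 2
  + lambdaX * norm1 X + muX / 2 * normF X ^+ 2
  + tau / 2 * TV eps nbr B.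

(* Main.v *)
(* Each of the three updates is a majorisation-minimisation step in one block
   of variables. Up to constants, the cost as a function of a column of [X], a
   row of [B] or a column of [C] is bounded by a nonnegative least squares cost
   plus a diagonal quadratic [d] and a linear term [l - g], with equality at the
   current iterate. Only the total variation needs a bound here: it contributes
   [tau P] to [d] and [tau P Z] to [g]. The multiplicative update is the
   minimiser of a separable majorant of that cost. Where a denominator vanishes
   at a positive entry, the cost does not depend on that entry, so the junk
   value [x / 0 = 0] is harmless. *)

Require Import Defs.
From mathcomp Require Import all_boot all_order all_algebra.
From mathcomp Require Import reals.
From mathcomp Require Import ring lra.

Set Implicit Arguments.
Unset Strict Implicit.
Unset Printing Implicit Defensive.

Import Order.TTheory GRing.Theory Num.Theory.
Local Open Scope ring_scope.

(** * Multiplicative updates for regularised nonnegative least squares *)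

(** By Lagrange's identity, twice the gap between the two sides is the sum of
    [w i * w j * (q i - q j) ^ 2] over all pairs. *)
Lemma weighted_cauchy (R : realFieldType) (I : finType) (w q : I -> R)
    (w_ge0 : forall i, 0 <= w i) :
  (\sum_i w i * q i) ^+ 2 <= (\sum_i w i) * \sum_i w i * q i ^+ 2.
Proof.
have : 0 <= \sum_i \sum_j w i * w j * (q i - q j) ^+ 2.
  apply: sumr_ge0 => i _; apply: sumr_ge0 => j _.
  by rewrite mulr_ge0 ?sqr_ge0 ?mulr_ge0.
suff -> : \sum_i \sum_j w i * w j * (q i - q j) ^+ 2
  = 2 * ((\sum_i w i) * (\sum_i w i * q i ^+ 2) - (\sum_i w i * q i) ^+ 2).
  by rewrite pmulr_rge0 ?subr_ge0 // ltr0n.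
have -> : \sum_i \sum_j w i * w j * (q i - q j) ^+ 2
  = \sum_i (w i * q i ^+ 2 * (\sum_j w j)
      + w i * (\sum_j w j * q j ^+ 2) - 2 * (w i * q i) * (\sum_j w j * q j)).
  apply: eq_bigr => i _; rewrite !mulr_sumr -big_split -sumrB /=.
  by apply: eq_bigr => j _; ring.
rewrite sumrB big_split /= -!mulr_suml -mulr_sumr; ring.
Qed.

(** The linear coefficient is split as [l - g] because its parts enter the update differently: [l]
    joins the denominator, [g] the numerator. *)
Definition ls_cost (R : realFieldType) (I S : finType) (a : R)
    (W : S -> I -> R) (y : S -> R) (d : I -> R) (l : R) (g x : I -> R) : R :=
  a / 2 * (\sum_r (\sum_i W r i * x i - y r) ^+ 2)
  + \sum_i (d i / 2 * x i ^+ 2 + (l - g i) * x i).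

(* With [x' = x q], Cauchy-Schwarz for the weights [W r i * x i] makes the
   coupled quadratic term separable; the linear term uses [2 q <= q ^ 2 + 1].
   Both are equalities at [q = 1], and [q] minimises the resulting bound. *)
Lemma ls_descent (R : realFieldType) (I S : finType) (a : R)
    (W : S -> I -> R) (y : S -> R) (d : I -> R) (l : R) (g x x' : I -> R)
    (a_ge0 : 0 <= a) (W_ge0 : forall r i, 0 <= W r i)
    (d_ge0 : forall i, 0 <= d i) (l_ge0 : 0 <= l)
    (x_ge0 : forall i, 0 <= x i) (g_supp : forall i, d i = 0 -> g i = 0)
    (x'E : forall i, x' i = x i * ((a * (\sum_r W r i * y r) + g i)
       / (a * (\sum_r W r i * \sum_j W r j * x j) + d i * x i + l))) :
  ls_cost a W y d l g x' <= ls_cost a W y d l g x.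
Proof.
pose s r := \sum_j W r j * x j.
pose D i := a * (\sum_r W r i * s r) + d i * x i + l.
pose b i := a * (\sum_r W r i * y r) + g i.
pose q i := b i / D i.
have {}x'E i : x' i = x i * q i by rewrite x'E.
have s_ge0 r : 0 <= s r by apply: sumr_ge0 => j _; rewrite mulr_ge0.
have Ws_ge0 i : 0 <= a * \sum_r W r i * s r.
  by rewrite mulr_ge0 // sumr_ge0 // => r _; rewrite mulr_ge0.
have D_ge0 i : 0 <= D i by rewrite !addr_ge0 // mulr_ge0.
(* [b i = D i * q i] can fail only when [D i = 0]. Then every nonnegative summand of [D i] vanishes;
   if [x i] is nonzero, so do [d i], hence [g i], and each [a * W r i], which gives [b i = 0]. *)
have bE i : x i * b i = x i * (D i * q i).
  have [Di0|Di0] := eqVneq (D i) 0; last by rewrite /q [D i * _]mulrC divfK.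
  have [->|xi0] := eqVneq (x i) 0; first by rewrite !mul0r.
  suff -> : b i = 0 by rewrite Di0 mul0r.
  have dx_ge0 : 0 <= d i * x i by rewrite mulr_ge0.
  have /eqP : d i * x i = 0.
    by have := Ws_ge0 i; move: Di0; rewrite /D; lra.
  rewrite mulf_eq0 (negPf xi0) orbF => /eqP di0.
  rewrite /b (g_supp _ di0) addr0.
  have [->|a0] := eqVneq a 0; first by rewrite mul0r.
  have /eqP : a * (\sum_r W r i * s r) = 0.
    by have := Ws_ge0 i; move: Di0; rewrite /D; lra.
  rewrite mulf_eq0 (negPf a0) /= psumr_eq0; last first.
    by move=> r _; rewrite mulr_ge0.
  move=> /allP Ws0; rewrite big1 ?mulr0 // => r _.
  have /eqP Wsr : W r i * s r == 0 by apply: Ws0; rewrite mem_index_enum.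
  (* [s r] dominates its own summand [W r i * x i], so [W r i * s r = 0] kills [W r i]. *)
  suff /eqP : W r i * (W r i * x i) = 0.
    by rewrite !mulf_eq0 (negPf xi0) orbF orbb => /eqP ->; rewrite mul0r.
  apply/eqP; rewrite eq_le [X in _ && X]mulr_ge0 ?mulr_ge0 // andbT.
  rewrite -Wsr ler_wpM2l // /s (bigD1 i) //= lerDl.
  by apply: sumr_ge0 => j _; rewrite mulr_ge0.
have sq_diff r :
  (\sum_i W r i * x' i - y r) ^+ 2 - (s r - y r) ^+ 2
    <= \sum_i W r i * x i * (s r * (q i ^+ 2 - 1) - 2 * y r * (q i - 1)).
  have := @weighted_cauchy R I (fun i => W r i * x i) q
    (fun i => mulr_ge0 (W_ge0 r i) (x_ge0 i)).
  have -> : \sum_i W r i * x' i = \sum_i W r i * x i * q i.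
    by apply: eq_bigr => i _; rewrite x'E mulrA.
  have -> : \sum_i W r i * x i * (s r * (q i ^+ 2 - 1) - 2 * y r * (q i - 1))
    = s r * (\sum_i W r i * x i * q i ^+ 2) - s r * s r
      - 2 * y r * (\sum_i W r i * x i * q i) + 2 * y r * s r.
    rewrite {4 5}/s !mulr_sumr -!sumrB -big_split /=.
    by apply: eq_bigr => i _; ring.
  rewrite -/(s r); nra.
rewrite -subr_le0 /ls_cost opprD addrACA -mulrBr -!sumrB.
(* The exact change of the bound left by Cauchy-Schwarz: completing the square at [q i] gives the
   [D i] part, and the [l] part is the slack in [2 q <= q ^ 2 + 1]. *)
apply: (@le_trans _ _ (\sum_i - (2^-1 * (D i * x i + l * x i)
                                    * (q i - 1) ^+ 2))); last first.
  rewrite sumrN oppr_le0 sumr_ge0 // => i _.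
  by rewrite mulr_ge0 ?sqr_ge0 // mulr_ge0 ?invr_ge0 // addr_ge0 ?mulr_ge0.
rewrite -lerBrDr -sumrB.
apply: (le_trans (ler_wpM2l _ (ler_sum _ (fun r _ => sq_diff r)))).
  by rewrite divr_ge0.
rewrite exchange_big /= mulr_sumr; apply: ler_sum => i _.
have -> : \sum_r W r i * x i * (s r * (q i ^+ 2 - 1) - 2 * y r * (q i - 1))
  = x i * ((\sum_r W r i * s r) * (q i ^+ 2 - 1)
           - 2 * (\sum_r W r i * y r) * (q i - 1)).
  rewrite -mulrA mulrBr !mulr_suml !mulr_sumr -sumrB.
  by apply: eq_bigr => r _; ring.
rewrite le_eqVlt; apply/orP; left; apply/eqP.
have bE' : x i * (a * (\sum_r W r i * y r)) = x i * (D i * q i) - x i * g i.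
  by rewrite -bE /b; ring.
have DE : a * (\sum_r W r i * s r) = D i - d i * x i - l by rewrite /D; ring.
rewrite x'E.
transitivity (x i / 2 * (q i ^+ 2 - 1) * (a * (\sum_r W r i * s r))
  - (q i - 1) * (x i * (a * (\sum_r W r i * y r)))); first by field.
by rewrite bE' DE; field.
Qed.

(** * Norms and products of nonnegative matrices *)

Lemma norm2_sqr (R : realType) (m : nat) (v : 'cV[R]_m) :
  norm2 v ^+ 2 = \sum_i v i 0 ^+ 2.
Proof. by rewrite sqr_sqrtr // sumr_ge0 // => i _; rewrite sqr_ge0. Qed.

Lemma normF_sqr (R : realType) (m n : nat) (A : 'M[R]_(m, n)) :
  normF A ^+ 2 = \sum_i \sum_j A i j ^+ 2.
Proof.
rewrite sqr_sqrtr // sumr_ge0 // => i _.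
by rewrite sumr_ge0 // => j _; rewrite sqr_ge0.
Qed.

Lemma norm1_nonneg (R : realType) (m n : nat) (A : 'M[R]_(m, n)) :
  mx_nonneg A -> norm1 A = \sum_i \sum_j A i j.
Proof.
by move=> A0; apply: eq_bigr => i _; apply: eq_bigr => j _; rewrite ger0_norm.
Qed.

Lemma mulmx_nonneg (R : realType) (m n p : nat) (A : 'M[R]_(m, n))
    (B : 'M[R]_(n, p)) : mx_nonneg A -> mx_nonneg B -> mx_nonneg (A *m B).
Proof.
by move=> A0 B0 i j; rewrite mxE sumr_ge0 // => k _; rewrite mulr_ge0.
Qed.

(** * Quadratic majorant of the smoothed total variation *)

Section TotalVariation.
Context (R : realType) (N K : nat) (eps : R) (nbr : 'I_N -> {set 'I_N}).
Hypothesis eps_gt0 : 0 < eps.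
Implicit Type B : 'M[R]_(N, K).

Lemma grad_arg_gt0 B n k :
  0 < eps ^+ 2 + \sum_(l in nbr n) (B n k - B l k) ^+ 2.
Proof.
by rewrite ltr_pwDl ?exprn_gt0 // sumr_ge0 // => l _; rewrite sqr_ge0.
Qed.

Lemma grad_abs_gt0 B n k : 0 < grad_abs eps nbr B n k.
Proof. by rewrite sqrtr_gt0 grad_arg_gt0. Qed.

Lemma grad_abs_sqr B n k :
  grad_abs eps nbr B n k ^+ 2
  = eps ^+ 2 + \sum_(l in nbr n) (B n k - B l k) ^+ 2.
Proof. by rewrite sqr_sqrtr // ltW // grad_arg_gt0. Qed.

Lemma TV_P_ge0 B n k : 0 <= TV_P eps nbr B n k.
Proof.
rewrite mxE addr_ge0 ?mulr_ge0 ?invr_ge0 ?sumr_ge0 // => *;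
  rewrite ?invr_ge0 //; exact/ltW/grad_abs_gt0.
Qed.

(* This also holds at an isolated pixel, where [P] and both sums vanish. *)
Lemma TV_PZ B n k :
  TV_P eps nbr B n k * TV_Z eps nbr B n k
  = \sum_(l in nbr n) (B n k + B l k) / 2 / grad_abs eps nbr B n k
    + \sum_(l in adj_nbr nbr n) (B n k + B l k) / 2 / grad_abs eps nbr B l k.
Proof.
have -> : \sum_(l in nbr n) (B n k + B l k) / 2 / grad_abs eps nbr B n k
  = (grad_abs eps nbr B n k)^-1 * \sum_(l in nbr n) (B n k + B l k) / 2.
  by rewrite mulr_sumr; apply: eq_bigr => l _; rewrite mulrC.
have -> : \sum_(l in adj_nbr nbr n) (B n k + B l k) / 2 / grad_abs eps nbr B l k
  = \sum_(l in adj_nbr nbr n) (B n k + B l k) / (2 * grad_abs eps nbr B l k).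
  by apply: eq_bigr => l _; rewrite invfM mulrA.
rewrite [TV_Z _ _ _ _ _]mxE.
have [P0|P0] := eqVneq (TV_P eps nbr B n k) 0; last by rewrite mulVKf.
(* All gradients are positive, so [P = 0] forces [nbr n] and [adj_nbr nbr n] to be empty. *)
rewrite P0 mul0r; move/eqP: P0; rewrite mxE paddr_eq0; last 2 first.
- by rewrite mulr_ge0 ?sumr_ge0 ?invr_ge0 // ltW // grad_abs_gt0.
- by rewrite sumr_ge0 // => l _; rewrite invr_ge0 ltW // grad_abs_gt0.
rewrite mulf_eq0 invr_eq0 (gt_eqF (grad_abs_gt0 B n k)) /=.
rewrite sumr_const pnatr_eq0 => /andP[/eqP/card0_eq nbr0].
rewrite psumr_eq0; last by move=> l _; rewrite invr_ge0 ltW // grad_abs_gt0.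
move=> /allP adj0; rewrite [X in _ * X + _]big_pred0 // mulr0 add0r big1 // => l nl.
have := adj0 l (mem_index_enum _).
by rewrite nl invr_eq0 (gt_eqF (grad_abs_gt0 B l k)).
Qed.

(* Concavity of the square root linearises it at [|grad B|]; then, with
   [m = (B_n + B_l) / 2], the bound [(u - v)^2 <= 2 (u - m)^2 + 2 (v - m)^2]
   decouples neighbouring pixels. Both bounds are tight at [B]. *)
Lemma TV_descent B B' :
  TV eps nbr B' - TV eps nbr B
  <= \sum_(n < N) \sum_(k < K)
       (TV_P eps nbr B n k * (B' n k ^+ 2 - B n k ^+ 2)
        - 2 * (TV_P eps nbr B n k * TV_Z eps nbr B n k) * (B' n k - B n k)).
Proof.
rewrite exchange_big /= -sumrB; apply: ler_sum => k _; rewrite -sumrB.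
pose gi n := (grad_abs eps nbr B n k)^-1.
pose u n := B n k; pose v n := B' n k.
(* With [m = (u n + u l) / 2], this is [(v n - m) ^ 2 - (u n - m) ^ 2]. *)
pose h n l := v n ^+ 2 - u n ^+ 2 - (u n + u l) * (v n - u n).
have gi_ge0 n : 0 <= gi n by rewrite invr_ge0 ltW // grad_abs_gt0.
have -> : \sum_(n < N)
       (TV_P eps nbr B n k * (B' n k ^+ 2 - B n k ^+ 2)
        - 2 * (TV_P eps nbr B n k * TV_Z eps nbr B n k) * (B' n k - B n k))
  = \sum_(n < N) \sum_(l in nbr n) gi n * h n l
    + \sum_(n < N) \sum_(l in adj_nbr nbr n) gi l * h n l.
  rewrite -big_split /=; apply: eq_bigr => n _.
  rewrite TV_PZ [TV_P _ _ _ _ _]mxE -/(gi n) -/(u n) -/(v n).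
  set a := v n ^+ 2 - _; set c := v n - u n.
  have split4 (p p' z z' : R) :
    (p + p') * a - 2 * (z + z') * c
    = p * a - z * (2 * c) + (p' * a - z' * (2 * c)).
    by ring.
  rewrite split4 mulr_sumr !mulr_suml -!sumrB.
  congr (_ + _); apply: eq_bigr => l _.
    by rewrite /h -/a -/c /u; field.
  by rewrite /h -/a -/c -/(gi l) /u; field.
(* Swapping the sums turns adjoint neighbourhoods back into [nbr], so each directed pair carries
   [h n l + h l n] with the single weight [gi n]. *)
have -> : \sum_(n < N) \sum_(l in adj_nbr nbr n) gi l * h n l
  = \sum_(n < N) \sum_(l in nbr n) gi n * h l n.
  rewrite (exchange_big_dep xpredT) //=.
  by apply: eq_bigr => n _; apply: eq_bigl => l; rewrite inE.
rewrite -big_split /=; apply: ler_sum => n _; rewrite -big_split /=.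
(* Tangent bound for the square root: [p' - p <= (p' ^ 2 - p ^ 2) / (2 p)], where [eps ^ 2] cancels
   in the difference of squares. *)
apply: (@le_trans _ _ (gi n / 2 * \sum_(l in nbr n)
   ((v n - v l) ^+ 2 - (u n - u l) ^+ 2))).
  have -> : \sum_(l in nbr n) ((v n - v l) ^+ 2 - (u n - u l) ^+ 2)
    = grad_abs eps nbr B' n k ^+ 2 - grad_abs eps nbr B n k ^+ 2.
    by rewrite sumrB !grad_abs_sqr /u /v; ring.
  rewrite /gi; have := grad_abs_gt0 B n k.
  move: (grad_abs eps nbr B n k) (grad_abs eps nbr B' n k) => p p' p_gt0.
  rewrite -subr_ge0.
  have -> : p^-1 / 2 * (p' ^+ 2 - p ^+ 2) - (p' - p)
     = p^-1 / 2 * (p' - p) ^+ 2 by field; rewrite gt_eqF.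
  by rewrite mulr_ge0 ?sqr_ge0 // divr_ge0 // invr_ge0 ltW.
rewrite mulr_sumr; apply: ler_sum => l _; rewrite -mulrDr -mulrA.
rewrite ler_wpM2l // /h -subr_ge0.
set z := (X in 0 <= X).
have -> : z = 2^-1 * (v n + v l - u n - u l) ^+ 2 by rewrite /z; field.
by rewrite mulr_ge0 ?sqr_ge0 // invr_ge0.
Qed.

Lemma TV_PZ_ge0 B n k : mx_nonneg B ->
  0 <= TV_P eps nbr B n k * TV_Z eps nbr B n k.
Proof.
move=> B0; rewrite TV_PZ addr_ge0 // sumr_ge0 // => l _;
  by rewrite !divr_ge0 ?addr_ge0 // ltW // grad_abs_gt0.
Qed.

End TotalVariation.

(** * Descent of the cost in each block of variables *)

Section Descent.
Context (R : realType) (M N T K : nat).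
Context (nbr : 'I_N -> {set 'I_N}) (eps : R) (A : 'I_T -> 'M[R]_(M, N)).
Context (Y : 'M[R]_(M, T)).
Context (alpha lambdaB muB lambdaC muC lambdaX muX tau : R).
Hypothesis eps_gt0 : 0 < eps.
Hypothesis A_ge0 : forall t, mx_nonneg (A t).
Hypotheses (alpha_ge0 : 0 <= alpha) (lambdaB_ge0 : 0 <= lambdaB).
Hypotheses (muB_ge0 : 0 <= muB) (lambdaC_ge0 : 0 <= lambdaC).
Hypotheses (muC_ge0 : 0 <= muC) (lambdaX_ge0 : 0 <= lambdaX).
Hypotheses (muX_ge0 : 0 <= muX) (tau_ge0 : 0 <= tau).

Let F := @cost R M N T K A Y alpha lambdaB muB lambdaC muC lambdaX muX tau eps nbr.

(** The coupling term is already diagonal in [X]: its square puts [alpha] into [d], its cross term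
    gives [g], and its constant part is the same for [X] and [X']. Only the data term mixes entries,
    hence [a = 1]. *)
Lemma cost_descent_X (B : 'M[R]_(N, K)) (C : 'M[R]_(K, T))
    (X X' : 'M[R]_(N, T)) (X_ge0 : mx_nonneg X) (X'_ge0 : mx_nonneg X')
    (X'E : forall n t, X' n t = X n t *
       (((\sum_m A t m n * Y m t) + alpha * (B *m C) n t)
        / ((\sum_m A t m n * \sum_j A t m j * X j t)
           + (muX + alpha) * X n t + lambdaX))) :
  F B C X' <= F B C X.
Proof.
pose g t n := alpha * (B *m C) n t.
pose L (Z : 'M[R]_(N, T)) t := ls_cost 1 (A t) (fun m => Y m t)
  (fun=> muX + alpha) lambdaX (g t) (fun n => Z n t).
have L_le t : L X' t <= L X t.
  apply: ls_descent => //.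
  - exact: A_ge0.
  - by move=> _; rewrite addr_ge0.
  - move=> n muXa0; rewrite /g; suff -> : alpha = 0 by rewrite mul0r.
    by move: muX_ge0 alpha_ge0 muXa0; lra.
  - by move=> n; rewrite X'E !mul1r.
have XE Z : mx_nonneg Z ->
  \sum_t (2^-1 * norm2 (A t *m col t Z - col t Y) ^+ 2)
  + alpha / 2 * normF (B *m C - Z) ^+ 2 + lambdaX * norm1 Z
  + muX / 2 * normF Z ^+ 2
  = \sum_t L Z t + alpha / 2 * \sum_n \sum_t (B *m C) n t ^+ 2.
  move=> Z_ge0; rewrite !normF_sqr norm1_nonneg //.
  rewrite ![\sum_(i < N) \sum_j _]exchange_big /= !mulr_sumr -!big_split /=.
  apply: eq_bigr => t _; rewrite norm2_sqr /L /ls_cost -!addrA.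
  congr (_ + _).
    rewrite mul1r; congr (_ * _); apply: eq_bigr => m _.
    by rewrite !mxE; congr ((_ - _) ^+ 2); apply: eq_bigr => j _; rewrite !mxE.
  rewrite !mulr_sumr -!big_split /=; apply: eq_bigr => n _.
  by rewrite /g [(B *m C - Z) n t]mxE [(- Z) n t]mxE; field.
have := ler_sum (P := xpredT) (index_enum 'I_T) (fun t _ => L_le t).
by have := XE _ X_ge0; have := XE _ X'_ge0; rewrite /F /cost; lra.
Qed.

(** Rows of [B] decouple once total variation is replaced by its diagonal surrogate; [TV_le]
    accounts for that exchange. *)
Lemma cost_descent_B (B B' : 'M[R]_(N, K)) (C : 'M[R]_(K, T))
    (X : 'M[R]_(N, T)) (B_ge0 : mx_nonneg B) (B'_ge0 : mx_nonneg B')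
    (C_ge0 : mx_nonneg C)
    (B'E : forall n k, B' n k = B n k *
       ((alpha * (\sum_t C k t * X n t)
         + tau * (TV_P eps nbr B n k * TV_Z eps nbr B n k))
        / (alpha * (\sum_t C k t * \sum_j C j t * B n j)
           + (muB + tau * TV_P eps nbr B n k) * B n k + lambdaB))) :
  F B' C X <= F B C X.
Proof.
pose P n k := TV_P eps nbr B n k; pose Z n k := TV_Z eps nbr B n k.
pose L (V : 'M[R]_(N, K)) n := ls_cost alpha (fun t k => C k t)
  (fun t => X n t) (fun k => muB + tau * P n k) lambdaB
  (fun k => tau * (P n k * Z n k)) (fun k => V n k).
have tauP_ge0 n k : 0 <= tau * P n k by rewrite mulr_ge0 // TV_P_ge0.
have L_le n : L B' n <= L B n.
  apply: ls_descent => //.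
  - by move=> k; rewrite addr_ge0.
  (* Both summands of [d] are nonnegative, so [d = 0] makes the factor [tau * P] of [g] vanish. *)
  - move=> k muBP0; suff tauP0 : tau * P n k = 0 by rewrite mulrA tauP0 mul0r.
    by have := tauP_ge0 n k; move: muB_ge0 muBP0; lra.
have BE V : mx_nonneg V ->
  alpha / 2 * normF (V *m C - X) ^+ 2 + lambdaB * norm1 V
  + muB / 2 * normF V ^+ 2
  + tau / 2 * \sum_n \sum_k (P n k * V n k ^+ 2 - 2 * (P n k * Z n k) * V n k)
  = \sum_n L V n.
  move=> V_ge0; rewrite !normF_sqr norm1_nonneg // !mulr_sumr -!big_split /=.
  apply: eq_bigr => n _; rewrite /L /ls_cost -!addrA; congr (_ + _).
    congr (_ * _); apply: eq_bigr => t _.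
    rewrite !mxE; congr ((_ - _) ^+ 2).
    by apply: eq_bigr => k _; rewrite mulrC.
  by rewrite !mulr_sumr -!big_split /=; apply: eq_bigr => k _; field.
have TV_le : tau / 2 * TV eps nbr B'
    + tau / 2 * \sum_n \sum_k (P n k * B n k ^+ 2 - 2 * (P n k * Z n k) * B n k)
  <= tau / 2 * TV eps nbr B
    + tau / 2 * \sum_n \sum_k (P n k * B' n k ^+ 2
                               - 2 * (P n k * Z n k) * B' n k).
  rewrite -!mulrDr ler_wpM2l ?divr_ge0 //.
  have := TV_descent nbr eps_gt0 B B'.
  set S := (X in _ <= X -> _).
  set S1 := (X in _ -> _ + X <= _); set S2 := (X in _ -> _ <= _ + X).
  suff -> : S = S2 - S1 by lra.
  rewrite -sumrB; apply: eq_bigr => n _; rewrite -sumrB.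
  by apply: eq_bigr => k _; rewrite /P /Z; ring.
have := ler_sum (P := xpredT) (index_enum 'I_N) (fun n _ => L_le n).
move: TV_le; have := BE _ B_ge0; have := BE _ B'_ge0; rewrite /F /cost; lra.
Qed.

(** Columns of [C] decouple exactly, with [g = 0], so the support condition on [g] is immediate. *)
Lemma cost_descent_C (B : 'M[R]_(N, K)) (C C' : 'M[R]_(K, T))
    (X : 'M[R]_(N, T)) (B_ge0 : mx_nonneg B) (C_ge0 : mx_nonneg C)
    (C'_ge0 : mx_nonneg C')
    (C'E : forall k t, C' k t = C k t *
       (alpha * (\sum_n B n k * X n t)
        / (alpha * (\sum_n B n k * \sum_j B n j * C j t)
           + muC * C k t + lambdaC))) :
  F B C' X <= F B C X.
Proof.
pose L (Z : 'M[R]_(K, T)) t := ls_cost alpha (fun n k => B n k)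
  (fun n => X n t) (fun=> muC) lambdaC (fun=> 0) (fun k => Z k t).
have L_le t : L C' t <= L C t.
  by apply: ls_descent => // k; rewrite C'E addr0.
have CE Z : mx_nonneg Z ->
  alpha / 2 * normF (B *m Z - X) ^+ 2 + lambdaC * norm1 Z
  + muC / 2 * normF Z ^+ 2 = \sum_t L Z t.
  move=> Z_ge0; rewrite !normF_sqr norm1_nonneg //.
  rewrite [\sum_(i < N) _]exchange_big ![\sum_(i < K) \sum_j _]exchange_big /=.
  rewrite !mulr_sumr -!big_split /=.
  apply: eq_bigr => t _; rewrite /L /ls_cost -!addrA; congr (_ + _).
    by congr (_ * _); apply: eq_bigr => n _; rewrite !mxE.
  by rewrite !mulr_sumr -!big_split /=; apply: eq_bigr => k _; field.
have := ler_sum (P := xpredT) (index_enum 'I_T) (fun t _ => L_le t).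
by have := CE _ C_ge0; have := CE _ C'_ge0; rewrite /F /cost; lra.
Qed.

End Descent.

(** * Iterates of the alternating scheme *)

Theorem theorem2p1 (R : realType) (M N T K : nat)
  (hM : (0 < M)%N) (hN : (0 < N)%N) (hT : (0 < T)%N) (hK : (0 < K)%N)
  (nbr : 'I_N -> {set 'I_N}) (eps : R) (heps : 0 < eps)
  (A : 'I_T -> 'M[R]_(M, N)) (hA : forall t, mx_nonneg (A t))
  (Y : 'M[R]_(M, T)) (hY : mx_nonneg Y)
  (alpha lambdaB muB lambdaC muC lambdaX muX tau : R)
  (halpha : 0 <= alpha) (hlambdaB : 0 <= lambdaB) (hmuB : 0 <= muB)
  (hlambdaC : 0 <= lambdaC) (hmuC : 0 <= muC)
  (hlambdaX : 0 <= lambdaX) (hmuX : 0 <= muX) (htau : 0 <= tau)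
  (X : nat -> 'M[R]_(N, T)) (B : nat -> 'M[R]_(N, K)) (C : nat -> 'M[R]_(K, T))
  (hX0 : mx_pos (X 0%N)) (hB0 : mx_pos (B 0%N)) (hC0 : mx_pos (C 0%N))
  (hX : forall (d : nat) (t : 'I_T),
     col t (X d.+1) =
       col t (X d) ⊙
         (((A t)^T *m col t Y + alpha *: (B d *m col t (C d)))
          ⊘ ((A t)^T *m A t *m col t (X d) + (muX + alpha) *: col t (X d)
             + lambdaX *: const_mx 1)))
  (hB : forall d : nat,
     B d.+1 =
       B d ⊙
         ((alpha *: (X d.+1 *m (C d)^T)
           + tau *: (TV_P eps nbr (B d) ⊙ TV_Z eps nbr (B d)))
          ⊘ (alpha *: (B d *m C d *m (C d)^T) + muB *: B d
             + lambdaB *: const_mx 1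
             + tau *: (B d ⊙ TV_P eps nbr (B d)))))
  (hC : forall d : nat,
     C d.+1 =
       C d ⊙
         ((alpha *: ((B d.+1)^T *m X d.+1))
          ⊘ (alpha *: ((B d.+1)^T *m B d.+1 *m C d) + muC *: C d
             + lambdaC *: const_mx 1))) :
  forall d : nat,
    cost A Y alpha lambdaB muB lambdaC muC lambdaX muX tau eps nbr
      (B d.+1) (C d.+1) (X d.+1)
    <= cost A Y alpha lambdaB muB lambdaC muC lambdaX muX tau eps nbr
      (B d) (C d) (X d).
Proof.
have XE d n t : X d.+1 n t = X d n t *
       (((\sum_m A t m n * Y m t) + alpha * (B d *m C d) n t)
        / ((\sum_m A t m n * \sum_j A t m j * X d j t)
           + (muX + alpha) * X d n t + lambdaX)).
  have /matrixP/(_ n 0) := hX d t; rewrite -mulmxA.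
  rewrite [col t (X d.+1) _ _]mxE => ->; rewrite !mxE mulr1.
  congr (_ * ((_ + _ * _) / (_ + _ + _)));
    apply: eq_bigr => m _; rewrite !mxE //.
  by congr (_ * _); apply: eq_bigr => j _; rewrite !mxE.
have BE d n k : B d.+1 n k = B d n k *
       ((alpha * (\sum_t C d k t * X d.+1 n t)
         + tau * (TV_P eps nbr (B d) n k * TV_Z eps nbr (B d) n k))
        / (alpha * (\sum_t C d k t * \sum_j C d j t * B d n j)
           + (muB + tau * TV_P eps nbr (B d) n k) * B d n k + lambdaB)).
  have /matrixP/(_ n k) := hB d.
  move: (TV_P eps nbr (B d)) (TV_Z eps nbr (B d)) => P Z ->.
  have -> : \sum_t C d k t * X d.+1 n t = (X d.+1 *m (C d)^T) n k.
    by rewrite mxE; apply: eq_bigr => t _; rewrite mxE mulrC.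
  have -> : \sum_t C d k t * (\sum_j C d j t * B d n j)
    = (B d *m C d *m (C d)^T) n k.
    rewrite mxE; apply: eq_bigr => t _; rewrite !mxE mulrC; congr (_ * _).
    by apply: eq_bigr => j _; rewrite mulrC.
  move: (X d.+1 *m (C d)^T) (B d *m C d *m (C d)^T) => V W.
  by rewrite !mxE; congr (_ * (_ / _)); ring.
have CE d k t : C d.+1 k t = C d k t *
       (alpha * (\sum_n B d.+1 n k * X d.+1 n t)
        / (alpha * (\sum_n B d.+1 n k * \sum_j B d.+1 n j * C d j t)
           + muC * C d k t + lambdaC)).
  have /matrixP/(_ k t) := hC d; rewrite -mulmxA => ->; rewrite !mxE mulr1.
  congr (_ * (_ * _ / (_ * _ + _ + _)));
    apply: eq_bigr => n _; rewrite !mxE //.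
(* Only nonnegativity propagates, since a zero numerator can annihilate an entry. It suffices to
   make the 1-norms linear and the denominators nonnegative. *)
have nonneg d : [/\ mx_nonneg (X d), mx_nonneg (B d) & mx_nonneg (C d)].
  elim: d => [|d [X0 B0 C0]]; first by split=> i j; apply: ltW.
  have X1 : mx_nonneg (X d.+1).
    move=> n t; rewrite XE mulr_ge0 // divr_ge0 // !addr_ge0 ?mulr_ge0 //.
    - by apply: sumr_ge0 => m _; rewrite mulr_ge0 // hA.
    - exact: mulmx_nonneg.
    - apply: sumr_ge0 => m _; rewrite mulr_ge0 ?hA //.
      by apply: sumr_ge0 => j _; rewrite mulr_ge0 // hA.
    - by rewrite addr_ge0.
  have B1 : mx_nonneg (B d.+1).
    move=> n k.
    rewrite BE mulr_ge0 // divr_ge0 // !addr_ge0 // mulr_ge0 ?TV_PZ_ge0 //.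
    - by apply: sumr_ge0 => t _; rewrite mulr_ge0.
    - apply: sumr_ge0 => t _; rewrite mulr_ge0 //.
      by apply: sumr_ge0 => j _; rewrite mulr_ge0.
    - by rewrite addr_ge0 // mulr_ge0 // TV_P_ge0.
  split=> // k t; rewrite CE mulr_ge0 // divr_ge0 // ?addr_ge0 ?mulr_ge0 //.
  - by apply: sumr_ge0 => n _; rewrite mulr_ge0.
  - apply: sumr_ge0 => n _; rewrite mulr_ge0 //.
    by apply: sumr_ge0 => j _; rewrite mulr_ge0.
move=> d; have [X0 B0 C0] := nonneg d; have [X1 B1 C1] := nonneg d.+1.
(* The updates are undone in reverse order: [C], then [B], then [X], each with the other blocks as
   its rule saw them. *)
apply: (@le_trans _ _ (cost A Y alpha lambdaB muB lambdaC muC lambdaX muX tau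
  eps nbr (B d.+1) (C d) (X d.+1))); first exact: cost_descent_C.
apply: (@le_trans _ _ (cost A Y alpha lambdaB muB lambdaC muC lambdaX muX tau
  eps nbr (B d) (C d) (X d.+1))); first exact: cost_descent_B.
exact: cost_descent_X.
Qed.
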